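(* Let $x>y\ge 1$ be integers. Then $$\frac{y+1}{x+1}=\frac{x\circ(y+1)}{y\circ(x+1)}$$ if and only if $x(x+1)=10\,y(y+1)$ and $\delta(x+1)=\delta(y+1)+1$.
   Context: For positive integers $a,b$ written in base 10, $a\circ b$ denotes the positive integer obtained by concatenating the decimal strings of $a$ and $b$; that is, $a\circ b=10^{s+1}a+b$, where $s+1$ is the number of decimal digits of $b$ (for instance $783\circ 56=78356$). For a positive real number $z$, $\delta(z)=\lfloor \log_{10} z\rfloor$; thus, for a positive integer $z$, $\delta(z)+1$ is the number of decimal digits of $z$. *)

(* Defs.v *)
From Stdlib Require Import Reals Lra Lia ZArith Arith.
From Stdlib Require Import DecimalFacts DecimalNat.

(* [Nat.to_uint] produces the decimal numeral without leading zeros, so for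
   b > 0 [Decimal.nb_digits (Nat.to_uint b)] is the usual number of digits. *)
Definition concat (a b : nat) : nat :=
  Nat.of_uint (Decimal.app (Nat.to_uint a) (Nat.to_uint b)).

(* [Int_part] is the floor function (also for negative arguments). The value is
   meaningful only for z > 0, since [ln] is a junk value elsewhere. *)
Definition delta (z : R) : Z := Int_part (Rlog 10 z).

Example concat_783_56 : Z.of_nat (concat 783 56) = 78356%Z.
Proof. vm_compute. reflexivity. Qed.

Lemma of_uint_acc_digits (d : Decimal.uint) (acc : nat) :
  Nat.of_uint_acc d acc = acc * 10 ^ Decimal.nb_digits d + Nat.of_uint d.
Proof.
  unfold Nat.of_uint; revert acc.
  induction d as [|d IH|d IH|d IH|d IH|d IH|d IH|d IH|d IH|d IH|d IH];
    intro acc; [simpl; lia|..];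
    cbn [Nat.of_uint_acc Decimal.nb_digits];
    rewrite ?Nat.tail_mul_spec, Nat.pow_succ_r', IH;
    match goal with |- _ = _ + Nat.of_uint_acc _ ?x => rewrite (IH x) end;
    ring.
Qed.

Lemma of_uint_app (d d' : Decimal.uint) :
  Nat.of_uint (Decimal.app d d') =
  10 ^ Decimal.nb_digits d' * Nat.of_uint d + Nat.of_uint d'.
Proof.
  assert (H : forall e acc, Nat.of_uint_acc (Decimal.app e d') acc =
                            Nat.of_uint_acc d' (Nat.of_uint_acc e acc)).
  { intros e.
    rewrite <- (of_list_to_list (Decimal.app e d')), app_spec.
    replace (Nat.of_uint_acc e) with (Nat.of_uint_acc (of_list (to_list e)))
      by now rewrite of_list_to_list.
    induction (to_list e) as [|c l IH]; intro acc.
    - simpl. now rewrite of_list_to_list.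
    - destruct c; simpl; apply IH. }
  change (Nat.of_uint_acc (Decimal.app d d') 0 =
          10 ^ Decimal.nb_digits d' * Nat.of_uint_acc d 0 + Nat.of_uint d').
  rewrite H, of_uint_acc_digits; ring.
Qed.

Lemma concatE (a b : nat) :
  concat a b = 10 ^ Decimal.nb_digits (Nat.to_uint b) * a + b.
Proof. unfold concat; now rewrite of_uint_app, !Unsigned.of_to. Qed.

Lemma of_uint_lt (d : Decimal.uint) :
  Nat.of_uint d < 10 ^ Decimal.nb_digits d.
Proof.
  unfold Nat.of_uint.
  induction d as [|d IH|d IH|d IH|d IH|d IH|d IH|d IH|d IH|d IH|d IH];
    [simpl; lia|..];
    cbn [Nat.of_uint_acc Decimal.nb_digits];
    rewrite ?Nat.tail_mul_spec, Nat.pow_succ_r', of_uint_acc_digits;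
    unfold Nat.of_uint; lia.
Qed.

Lemma to_uint_bounds (n : nat) (hn : 0 < n) :
  exists k, Decimal.nb_digits (Nat.to_uint n) = S k /\ 10 ^ k <= n < 10 ^ S k.
Proof.
  pose proof (of_uint_lt (Nat.to_uint n)) as Hlt.
  rewrite Unsigned.of_to in Hlt.
  assert (Hn : Decimal.unorm (Nat.to_uint n) = Nat.to_uint n)
    by now rewrite <- (Unsigned.to_of (Nat.to_uint n)), Unsigned.of_to.
  pose proof (Unsigned.of_to n) as Hof.
  destruct (Nat.to_uint n) as [|d|d|d|d|d|d|d|d|d|d] eqn:E;
    try (cbv in Hof; lia); cbn [Decimal.nb_digits] in *;
    [|exists (Decimal.nb_digits d); repeat split; auto;
      rewrite <- Hof; unfold Nat.of_uint; cbn [Nat.of_uint_acc];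
      rewrite of_uint_acc_digits, ?Nat.tail_mul_spec; lia ..].
  exfalso; unfold Decimal.unorm in Hn.
  destruct (Decimal.nzhead (Decimal.D0 d)) eqn:E'; try discriminate.
  - injection Hn as <-; cbv in Hof; lia.
  - now apply nzhead_nonzero in E'.
Qed.

Lemma delta_digits (n : nat) (hn : 0 < n) :
  (delta (INR n) + 1)%Z = Z.of_nat (Decimal.nb_digits (Nat.to_uint n)).
Proof.
  destruct (to_uint_bounds n hn) as [k [-> [Hlo Hhi]]].
  apply le_INR in Hlo; apply lt_INR in Hhi.
  rewrite pow_INR in Hlo, Hhi.
  replace (INR 10) with 10%R in Hlo, Hhi by (simpl; lra).
  assert (Hpos : (0 < INR n)%R) by now apply lt_0_INR.
  assert (Hln : (0 < ln 10)%R) by (rewrite <- ln_1; apply ln_increasing; lra).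
  assert (Hk : (0 < 10 ^ k)%R) by (apply pow_lt; lra).
  assert (H1 : (INR k <= Rlog 10 (INR n))%R).
  { rewrite <- (Rlog_pow 10 k) by lra; unfold Rlog, Rdiv.
    apply Rmult_le_compat_r; [left; now apply Rinv_0_lt_compat|].
    destruct Hlo as [Hlo | Hlo]; [left; now apply ln_increasing|].
    right; now rewrite Hlo. }
  assert (H2 : (Rlog 10 (INR n) < INR (S k))%R).
  { rewrite <- (Rlog_pow 10 (S k)) by lra; unfold Rlog, Rdiv.
    apply Rmult_lt_compat_r; [now apply Rinv_0_lt_compat|].
    now apply ln_increasing. }
  unfold delta; rewrite <- (Int_part_spec _ (Z.of_nat k)); [lia|].
  rewrite <- INR_IZR_INZ; rewrite S_INR in H2; lra.
Qed.

(* Main.v *)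
Require Import Defs.
From Stdlib Require Import Reals ZArith.
From Stdlib Require Import Lra Lia.

(* Let m and n be the numbers of digits of x+1 and y+1. Cross-multiplying, the
   equation of fractions becomes 10^m y(y+1) = 10^n x(x+1), so m > n. If
   m = n+1+e, then x+1 > 10^e (y+1) by counting digits, hence x >= 10^e y and
   10^(1+e) y(y+1) = x(x+1) > 10^(2e) y(y+1), which forces e = 0. *)

Lemma div_INR_eq_iff (a b c d : nat) (hb : 0 < b) (hd : 0 < d) :
  (INR a / INR b = INR c / INR d)%R <-> a * d = b * c.
Proof.
  apply lt_0_INR in hb, hd.
  split; intro H.
  - apply INR_eq; rewrite !mult_INR.
    replace (INR a) with (INR a / INR b * INR b)%R by (field; lra).
    rewrite H; field; lra.
  - apply (f_equal INR) in H; rewrite !mult_INR in H.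
    apply (Rmult_eq_reg_r (INR b * INR d)); [|nra].
    transitivity (INR a * INR d)%R; [field; lra|].
    rewrite H; field; lra.
Qed.

(** The bounds encode digit counts: at most [n] digits for [y + 1], at least [n + e + 1] for
    [x + 1]. *)
Lemma excess_digits_eq0 (x y n e : nat) (hy : 1 <= y) (hyn : y + 1 < 10 ^ n)
  (hxn : 10 ^ (n + e) <= x + 1)
  (H : x * (x + 1) = 10 ^ S e * (y * (y + 1))) : e = 0.
Proof.
  rewrite Nat.pow_add_r in hxn; rewrite Nat.pow_succ_r' in H.
  destruct e as [|e]; [reflexivity|exfalso].
  assert (Ht : 10 <= 10 ^ S e).
  { rewrite Nat.pow_succ_r'; pose proof (Nat.pow_nonzero 10 e); lia. }
  set (t := 10 ^ S e) in *; clearbody t.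
  (* Both bounds meet at [t * 10 ^ n]. *)
  assert (H1 : t * (y + 1) < x + 1) by nia.
  assert (H2 : t * y <= x) by nia.
  assert (H3 : t * y * (t * (y + 1)) < x * (x + 1)).
  { apply Nat.le_lt_trans with (x * (t * (y + 1))).
    - now apply Nat.mul_le_mono_r.
    - apply Nat.mul_lt_mono_pos_l; lia. }
  (* By [H] the left side is [x * (x + 1)], so [H3] is contradicted. *)
  assert (H4 : 10 * (t * (y * (y + 1))) <= t * (t * (y * (y + 1))))
    by now apply Nat.mul_le_mono_r.
  lia.
Qed.

Theorem lemma1 (x y : nat) (hy : (1 <= y)%nat) (hxy : (y < x)%nat) :
  (INR (y + 1) / INR (x + 1) = INR (concat x (y + 1)) / INR (concat y (x + 1)))%R
  <->
  ((x * (x + 1) = 10 * (y * (y + 1)))%nat /\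
   delta (INR (x + 1)) = (delta (INR (y + 1)) + 1)%Z).
Proof.
  pose proof (delta_digits (x + 1) ltac:(lia)) as Dx.
  pose proof (delta_digits (y + 1) ltac:(lia)) as Dy.
  destruct (to_uint_bounds (x + 1) ltac:(lia)) as [k [Ex [Bx _]]].
  destruct (to_uint_bounds (y + 1) ltac:(lia)) as [l [Ey [_ By]]].
  rewrite div_INR_eq_iff by (rewrite ?concatE; lia).
  rewrite !concatE.
  rewrite Ex in *; rewrite Ey in *.
  split.
  - intro H.
    (* The common term [(x + 1) * (y + 1)] cancels. *)
    assert (H' : 10 ^ S k * (y * (y + 1)) = 10 ^ S l * (x * (x + 1))) by lia.
    assert (Hkl : l < k).
    { destruct (Nat.lt_ge_cases l k) as [|Hle]; [assumption|exfalso].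
      assert (Hp : 10 ^ S k <= 10 ^ S l) by (apply Nat.pow_le_mono_r; lia).
      assert (Hq : 10 ^ S l <> 0) by (apply Nat.pow_nonzero; lia).
      assert (y * (y + 1) < x * (x + 1)) by nia.
      nia. }
    (* The digit counts are [S k] and [S l], so [e] is the excess of their difference over 1. *)
    destruct (Nat.le_exists_sub (S l) k Hkl) as [e [-> _]].
    replace (S (e + S l)) with (S l + S e) in H' by lia.
    rewrite Nat.pow_add_r, <- Nat.mul_assoc in H'.
    apply Nat.mul_cancel_l in H'; [|apply Nat.pow_nonzero; lia].
    rewrite Nat.add_comm in Bx.
    assert (He : e = 0) by
      now apply (excess_digits_eq0 x y (S l) e); [| | |symmetry].
    subst e; split; [now rewrite <- H'|lia].
  - intros [H Hd].
    (* [Dx] and [Dy] turn [Hd] into a relation between digit counts. *)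
    assert (k = S l) by lia; subst k.
    rewrite (Nat.pow_succ_r' 10 (S l)).
    (* Scaling by [10 ^ S l] and adding [(x + 1) * (y + 1)] to both sides restores the
       cross-multiplied equation. *)
    apply (f_equal (Nat.mul (10 ^ S l))) in H; lia.
Qed.
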